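(* For all integers $\Delta,k\geq 1$, there exists an integer $f(\Delta,k)$ such that the following holds. For every ordered graph $H$ with maximum degree $\Delta(H)\leq\Delta$ and interval chromatic number $\chi_<(H)\leq k$, there is a constant $C_H$ such that, for every integer $n\geq 1$, $$R_<(H,K_n)\leq C_H\, n^{f(\Delta,k)}.$$
   Context: All graphs are finite and simple. An ordered graph is a graph equipped with a linear order on its vertex set. A copy of an ordered graph $G$ in an ordered graph $G'$ is a (not necessarily induced) subgraph of $G'$ isomorphic to $G$ via an order-preserving isomorphism. For ordered graphs $G,H$, the ordered Ramsey number $R_<(G,H)$ is the minimum $N$ such that every red/blue coloring of the edges of the complete graph $K_N$ with linearly ordered vertex set contains a red copy of $G$ or a blue copy of $H$ (as ordered graphs). Here $K_n$ is the complete graph on $n$ linearly ordered vertices. The interval chromatic number $\chi_<(H)$ is the minimum number of intervals (sets of consecutive vertices in the vertex order), each an independent set, into which $V(H)$ can be partitioned. *)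

(* Defs.v *)
From mathcomp Require Import all_boot all_order.

Set Implicit Arguments.
Unset Strict Implicit.
Unset Printing Implicit Defensive.

Import Order.TTheory.

Record ordered_graph := OrderedGraph {
  disp : Order.disp_t;
  vertex :> finOrderType disp;
  edge : rel vertex;
  edge_sym : symmetric edge;
  edge_irr : irreflexive edge
}.

Definition max_degree (G : ordered_graph) : nat :=
  \max_(x : G) #|[set y | edge x y]|.

(* Sets of consecutive vertices. *)
Definition is_interval (G : ordered_graph) (A : {set G}) : bool :=
  [forall x in A, forall z in A, forall y, (x <= y <= z)%O ==> (y \in A)].

Definition independent (G : ordered_graph) (A : {set G}) : bool :=
  [forall x in A, forall y in A, ~~ edge x y].

Definition interval_coloring (G : ordered_graph) (P : {set {set G}}) : bool :=
  partition P [set: G]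
  && [forall A in P, is_interval A && independent A].

(* The default value #|G| is the size of the partition into singletons, so it
   does not affect the minimum; see interval_chromatic_numberP. *)
Definition interval_chromatic_number (G : ordered_graph) : nat :=
  \big[minn/#|G|]_(P : {set {set G}} | interval_coloring P) #|P|.

(* A strictly increasing map sending edges to edges is an order-preserving
   isomorphism of G onto a (not necessarily induced) subgraph of G'. *)
Definition contains_copy (G G' : ordered_graph) : Prop :=
  exists phi : G -> G',
    {homo phi : x y / (x < y)%O} /\ {homo phi : x y / edge x y}.

Fact complete_sym n : symmetric (fun x y : 'I_n => x != y).
Proof. by move=> x y; rewrite eq_sym. Qed.

Fact complete_irr n : irreflexive (fun x y : 'I_n => x != y).
Proof. by move=> x; rewrite eqxx. Qed.

Definition complete (n : nat) : ordered_graph :=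
  OrderedGraph (@complete_sym n) (@complete_irr n).

(* A red/blue coloring of the edges of K_N is a function on sets of vertices,
   of which only the values at two-element sets matter; true is red and false
   is blue. *)
Section ColorClass.
Variables (N : nat) (c : {set complete N} -> bool) (b : bool).

Definition color_edge : rel (complete N) :=
  fun x y => edge x y && (c [set x; y] == b).

Fact color_edge_sym : symmetric color_edge.
Proof. by move=> x y; rewrite /color_edge edge_sym setUC. Qed.

Fact color_edge_irr : irreflexive color_edge.
Proof. by move=> x; rewrite /color_edge edge_irr. Qed.

Definition color_class : ordered_graph :=
  OrderedGraph color_edge_sym color_edge_irr.
End ColorClass.

Definition ramsey_property (G H : ordered_graph) (N : nat) : Prop :=
  forall c : {set complete N} -> bool,
    contains_copy G (color_class c true)
    \/ contains_copy H (color_class c false).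

Definition is_ordered_ramsey_number (G H : ordered_graph) (N : nat) : Prop :=
  ramsey_property G H N
  /\ forall M : nat, ramsey_property G H M -> N <= M.

Lemma interval_coloring_singletons (G : ordered_graph) :
  interval_coloring [set [set x] | x in [set: G]].
Proof.
apply/andP; split.
  apply/and3P; split.
  - rewrite eqEsubset subsetT; apply/subsetP => x _.
    by apply/bigcupP; exists [set x]; rewrite ?imset_f ?inE.
  - apply/trivIsetP => _ _ /imsetP[x _ ->] /imsetP[y _ ->] neq.
    by rewrite disjoints1 inE; apply: contra neq => /eqP->.
  - by apply/imsetP => -[x _ /setP/(_ x)]; rewrite !inE eqxx.
apply/forall_inP => _ /imsetP[a _ ->]; apply/andP; split.
  apply/forall_inP => x /set1P->; apply/forall_inP => z /set1P->.
  by apply/forallP => y; apply/implyP => ay; rewrite inE eq_sym eq_le.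
by apply/forall_inP => x /set1P->; apply/forall_inP => z /set1P->;
  rewrite edge_irr.
Qed.

Lemma interval_chromatic_numberP (G : ordered_graph) :
  (exists2 P : {set {set G}},
     interval_coloring P & #|P| = interval_chromatic_number G)
  /\ forall P : {set {set G}},
     interval_coloring P -> interval_chromatic_number G <= #|P|.
Proof.
rewrite /interval_chromatic_number; split; last first.
  move=> P cP; have := mem_index_enum P.
  elim: (index_enum _) => // Q s IHs; rewrite inE big_cons => /predU1P[<-|sP].
    by rewrite cP geq_minl.
  by case: ifP => _; rewrite ?geq_min IHs ?orbT.
apply: (big_ind (fun m => exists2 P : {set {set G}},
                   interval_coloring P & #|P| = m)).
- exists [set [set x] | x in [set: G]].
    exact: interval_coloring_singletons.
  by rewrite card_imset ?cardsT //; apply: set1_inj.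
- by move=> m n [P cP <-] [Q cQ <-]; rewrite /minn; case: ifP => _;
    [exists P | exists Q].
- by move=> P cP; exists P.
Qed.

(* Main.v *)
Require Import Defs.
From mathcomp Require Import all_boot all_order.
From mathcomp Require Import zify.
From Stdlib Require Import Classical.

(** Suppose there is no blue copy of K_n.  Cut n ^ k * M vertices into n ^ k
    intervals of length M.  By the bound R(K_k, K_n) <= n ^ k, every transversal
    of the intervals contains a red K_k, so averaging gives k intervals spanning
    at least M ^ k / q red transversal copies of K_k, where q = n ^ (k * k)
    (dense_intervals).  It remains to embed H, part i of an interval coloring
    going to the i-th interval, as soon as M >= c * q ^ f, where c may depend
    on H but f may not (copies_exist).

    The parts are removed from the last one.  Dependent random choice picks a
    vector z of boundedly many anchors in the last interval and restricts the
    other intervals to the common neighbours of the anchors: this costs only a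
    polynomial factor in the density of K_(k-1), while every d-tuple S of the
    remaining vertices that is bad in a sufficiently rare sense disappears; here
    d bounds the number of earlier neighbours of a vertex of H.
    Ordinary dependent random choice would call S bad if it has few common
    neighbours.  Now the common neighbours must moreover be available in a
    prescribed order, and badness measures how they are spread out around the
    anchors.  Write positions in base B with R digits, where B ^ R is about M
    and the number R of levels depends on H only.  A vertex w branches from y at
    level l if its first digit that differs from y, read from the top, is digit
    l, and is larger there.  Vertices branching from y at higher levels come
    later in the order (branches_lt), so that choosing levels means choosing an
    order.  A vector z of anchors in a set Y is determined by the pairs
    (anchor, level) at which Y branches from z together with the digits of z at
    these pairs only, since at the other pairs the digit is as large as Y
    permits.  Hence the vectors z from which Y branches only at an unusually
    small set of pairs form, up to constants, a proportion of at most
    M ^ (- d - 1) of all vectors (card_few_branchings), and this beats the M ^ d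
    choices of S.

    Each S now offers a large set of pairs, its type, at which a common
    neighbour is available.  To place the vertices of one part in the right
    order their types must share an anchor and many levels.  Types are colors of
    d-tuples and the number of colors depends on H only; so the induction proves
    more: for every coloring of tuples there is a copy of H whose tuples receive
    at most s colors, where s does not depend on H nor on the number of colors.
    Few types, each missing a small enough fraction of all pairs, have a large
    intersection.  The stronger statement passes through the step because a
    tuple using vertices of the last part is determined by a longer tuple in the
    earlier parts and by the levels used, and a Ramsey argument on the levels
    (few_colors) leaves boundedly many colors again. *)

Set Implicit Arguments.
Unset Strict Implicit.
Unset Printing Implicit Defensive.

Import Order.TTheory.

(** * Ramsey theory of sequences *)

(** The state of the Erdos-Rado argument: w lists elements with colors, and the
    color of a (D+1)-subsequence of the elements is the color attached to its
    first term. *)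
Fixpoint prehom (A : eqType) (C : Type) (D : nat) (col : seq A -> C)
    (w : seq (A * C)) : Prop :=
  if w is (y, g) :: w' then
    (forall z, subseq z (unzip1 w') -> size z = D -> col (y :: z) = g)
    /\ prehom D col w'
  else True.

(** Keeping the entries with one attached color makes the sequence
    homogeneous. *)
Lemma prehom_filter (A C : eqType) D (col : seq A -> C) w g :
  prehom D col w ->
  forall z, subseq z (unzip1 [seq p <- w | p.2 == g]) -> size z = D.+1 ->
  col z = g.
Proof.
elim: w => [|[y g'] w IHw] /= => [_ z|[Hy /IHw{}IHw] z].
  by case: z.
case: ifP => [/eqP Eg /=|_]; last exact: IHw.
case: z => // a z; rewrite /=; case: eqP => [-> sub [sz]|_]; last exact: IHw.
rewrite -Eg; apply: Hy => //; apply: subseq_trans sub _.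
exact/map_subseq/filter_subseq.
Qed.

Lemma size_sum_count (C : finType) (s : seq C) :
  size s = \sum_(c : C) count_mem c s.
Proof.
elim: s => [|x s IHs] /=; first by rewrite big1.
rewrite big_split /= -IHs (bigD1 x) //= eqxx big1 ?addn0 ?add1n // => c.
by rewrite eq_sym => /negPf->.
Qed.

Lemma pigeonhole_count (C : finType) (s : seq C) n :
  #|C| * n < size s -> exists c, n <= count_mem c s.
Proof.
move=> lt_s; apply/existsP; apply: contraLR lt_s; rewrite negb_exists => /forallP lt.
rewrite -leqNgt size_sum_count -sum_nat_const leq_sum // => c _.
by rewrite ltnW // ltnNge.
Qed.

(** Ramsey's theorem for D-uniform hypergraphs.  Speaking of subsequences
    instead of subsets lets the induction on D peel off first terms. *)
Lemma ramsey_subseq (D : nat) (C : finType) (N : nat) :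
  exists L, forall (A : eqType) (s : seq A) (col : seq A -> C), L <= size s ->
  exists s' g, [/\ subseq s' s, size s' = N
    & forall z, subseq z s' -> size z = D -> col z = g].
Proof.
elim: D N => [|D IHD] N.
  exists N => A s col le_s; exists (take N s), (col [::]).
  by split; rewrite ?take_subseq ?size_takel // => z _ /size0nil->.
have prehomE n : exists L, forall (A : eqType) (s : seq A) (col : seq A -> C),
    L <= size s -> exists w,
    [/\ subseq (unzip1 w) s, size w = n & prehom D col w].
  elim: n => [|n [L1 HL1]].
    by exists 0 => A s col _; exists [::]; rewrite sub0seq.
  have [L2 HL2] := IHD L1; exists L2.+1 => A [//|y s] col /= le_s.
  have [s1 [g [sub1 sz1 hom1]]] := HL2 A s (fun z => col (y :: z)) le_s.
  have [|w [subw szw prew]] := HL1 A s1 col; first by rewrite sz1.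
  exists ((y, g) :: w); split=> /=; [|by rewrite szw|split=> //].
    by rewrite eqxx (subseq_trans subw).
  by move=> z subz; apply: hom1; apply: (subseq_trans subz subw).
have [L HL] := prehomE (#|C| * N).+1; exists L => A s col le_s.
have [w [subw szw prew]] := HL A s col le_s.
have [g le_g] : exists g, N <= count_mem g (unzip2 w).
  by apply: pigeonhole_count; rewrite size_map szw.
have hom := prehom_filter (g := g) prew.
set v := unzip1 _ in hom; exists (take N v), g; split.
- apply: subseq_trans (take_subseq _ _) _; apply: subseq_trans subw.
  exact/map_subseq/filter_subseq.
- rewrite size_takel // size_map size_filter.
  by move: le_g; rewrite count_map.
- by move=> z subz; apply: hom; apply: (subseq_trans subz (take_subseq _ _)).
Qed.

Lemma subset_of_card (T : finType) (X Y : {set T}) n :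
  X \subset Y -> #|X| <= n <= #|Y| ->
  exists Z : {set T}, [/\ X \subset Z, Z \subset Y & #|Z| = n].
Proof.
move=> sXY /andP[le_X le_Y].
have [m Em] : exists m, n = #|X| + m by exists (n - #|X|); rewrite subnKC.
elim: m n X sXY Em {le_X} le_Y => [|m IHm] n X sXY Em le_Y.
  by exists X; rewrite Em addn0.
have /subsetPn[y yY yX] : ~~ (Y \subset X).
  by apply: contraTN le_Y => /subset_leq_card; lia.
have cX : #|y |: X| = #|X|.+1 by rewrite cardsU1 yX.
have [||//|Z [sXZ sZY cZ]] := IHm n (y |: X); rewrite ?cX ?addSn -?addnS //.
  by rewrite subUset sub1set yY.
by exists Z; split=> //; apply: subset_trans sXZ; apply: subsetUr.
Qed.

Lemma enum_subseq (T : finType) (X Y : {set T}) :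
  X \subset Y -> subseq (enum X) (enum Y).
Proof.
move=> /subsetP sXY; rewrite /enum_mem.
suff -> : [seq x <- Finite.enum T | mem X x]
        = [seq x <- [seq x <- Finite.enum T | mem Y x] | mem X x].
  exact: filter_subseq.
rewrite -filter_predI; apply: eq_filter => x /=.
by case xX: (x \in X); rewrite //= sXY.
Qed.

(** Ramsey's theorem for functions instead of subsets: a function x into an
    ordered set is an increasing sequence listing at least its values, together
    with the pattern telling which term is x i.  On a homogeneous set only the
    pattern influences the color.  The point is that the number of remaining
    colors depends on I alone. *)
Lemma few_colors (I C : finType) (N : nat) :
  exists L, forall R (Y : {set 'I_R}) (col : {ffun I -> 'I_R} -> C), L <= #|Y| ->
  exists (Y' : {set 'I_R}) (K : {set C}),
    [/\ Y' \subset Y, N <= #|Y'|, #|K| <= #|{ffun I -> 'I_#|I|}|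
      & forall x : {ffun I -> 'I_R}, (forall i, x i \in Y') -> col x \in K].
Proof.
pose Pat := {ffun I -> 'I_#|I|}.
have [L HL] := ramsey_subseq #|I| {ffun Pat -> C} (N + #|I|).
exists L.+1 => R Y col ltL.
have /card_gt0P[y0 _] : 0 < #|Y| by apply: leq_ltn_trans ltL.
(* One color for a sequence records the colors of all patterns on it. *)
pose col' (z : seq 'I_R) : {ffun Pat -> C} :=
  [ffun pi : Pat => col [ffun i => nth y0 z (pi i)]].
have [|s [g [subs szs hom]]] := HL _ (enum Y) col'.
  by rewrite -cardE; apply: leq_trans ltL.
have uniqs : uniq s by apply: subseq_uniq subs (enum_uniq _).
exists [set x in s], [set g pi | pi : Pat]; split.
- by apply/subsetP=> x; rewrite inE => /(mem_subseq subs); rewrite mem_enum.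
- by rewrite cardsE (card_uniqP uniqs) szs leq_addr.
- by apply: leq_trans (leq_imset_card _ _) _.
move=> x xs.
(* The values of x may be fewer than #|I|; they are padded inside s. *)
have [||Z [sXZ sZs cZ]] := @subset_of_card _ [set x i | i : I] [set x in s] #|I|.
- by apply/subsetP=> _ /imsetP[i _ ->].
- rewrite cardsE (card_uniqP uniqs) szs leq_addl andbT.
  exact: leq_imset_card.
pose z := [seq y <- s | y \in Z].
have subz : subseq z s by apply: filter_subseq.
have memz y : (y \in z) = (y \in Z).
  rewrite mem_filter; case yZ: (y \in Z) => //=.
  by move/subsetP: sZs => /(_ y yZ); rewrite inE.
have szz : size z = #|I|.
  rewrite -cZ -(card_uniqP (subseq_uniq subz uniqs)).
  by apply: eq_card => y; rewrite memz.
have xz i : x i \in z by rewrite memz (subsetP sXZ) // imset_f.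
have ltx i : index (x i) z < #|I| by rewrite -szz index_mem.
apply/imsetP; exists [ffun i => Ordinal (ltx i)] => //.
rewrite -(hom z) // ffunE; congr col; apply/ffunP=> i.
by rewrite !ffunE /= nth_index.
Qed.

(** * Digits and anchors *)

(** In base B, the digits of w and y agree above position l, and w has the
    larger digit at position l. *)
Definition branches (B l y w : nat) : bool :=
  (w %/ B ^ l.+1 == y %/ B ^ l.+1) && (y %/ B ^ l < w %/ B ^ l).

(** Branching at a higher level l' is decided by digits at which w, branching
    only at level l, still agrees with y. *)
Lemma branches_lt B l l' y w w' :
  0 < B -> l < l' -> branches B l y w -> branches B l' y w' -> w < w'.
Proof.
move=> B_gt0 lt_l /andP[/eqP Ew _] /andP[_ lt_w'].
rewrite ltnNge; apply: contraL lt_w' => le_w'; rewrite -leqNgt.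
have -> : B ^ l' = B ^ l.+1 * B ^ (l' - l.+1) by rewrite -expnD subnKC.
by rewrite !divnMA -Ew -!divnMA leq_div2r.
Qed.

Definition branching_levels (B R t M : nat) (Y : {set 'I_M})
    (z : {ffun 'I_t -> 'I_M}) : {set 'I_t * 'I_R} :=
  [set al : 'I_t * 'I_R | [exists w in Y, branches B al.2 (z al.1) w]].

Section FewBranchings.
Variables (B R t M : nat) (Y : {set 'I_M}).
Hypotheses (B_gt0 : 0 < B) (leMB : M <= B ^ R).

(** Reading digits from the top: if Y does not branch from z a at level l, then
    z a has the largest digit at l among the members of Y with the same higher
    digits, so this digit carries no information.  Two vectors with the same
    branching pairs and the same digits there agree everywhere. *)
Lemma eq_of_branchings (z z' : {ffun 'I_t -> 'I_M}) :
  (forall a, z a \in Y) -> (forall a, z' a \in Y) ->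
  branching_levels B R Y z = branching_levels B R Y z' ->
  (forall al, al \in branching_levels B R Y z ->
     z al.1 %/ B ^ al.2 = z' al.1 %/ B ^ al.2 %[mod B]) ->
  z = z'.
Proof.
move=> zY z'Y eqD eqd; apply/ffunP => a; apply/val_inj => /=.
suff eq_pref j : j <= R -> z a %/ B ^ (R - j) = z' a %/ B ^ (R - j).
  by have := eq_pref R (leqnn R); rewrite subnn expn0 !divn1.
elim: j => [_|j IHj ltj].
  by rewrite subn0 !divn_small // (leq_trans (ltn_ord _)).
have := IHj (ltnW ltj).
have -> : R - j = (R - j.+1).+1 by rewrite -subSn.
have ltR : R - j.+1 < R by rewrite ltn_subrL (leq_trans _ ltj).
set l := R - j.+1 in ltR *; move=> eq_up.
have [al_in|/[dup]] := boolP ((a, Ordinal ltR) \in branching_levels B R Y z).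
  have /= eq_dig := eqd _ al_in.
  by rewrite (divn_eq (z a %/ B ^ l) B) (divn_eq (z' a %/ B ^ l) B) eq_dig
    -!divnMA -!expnSr eq_up.
rewrite {2}eqD !inE !negb_exists_in /= => /forall_inP/(_ _ (z'Y a)) nb.
move=> /forall_inP/(_ _ (zY a)) nb'.
by apply/eqP; rewrite eqn_leq; apply/andP; split; rewrite leqNgt;
  [move: nb' | move: nb]; rewrite /branches eq_up eqxx.
Qed.

(** There are at most 2 ^ (t * R) sets of pairs and at most B ^ h choices of
    digits on a set of h pairs.  When B ^ R is about M, only a constant times
    M ^ (h / R) of the M ^ t vectors are few-branching, whatever Y is. *)
Lemma card_few_branchings h :
  #|[set z : {ffun 'I_t -> 'I_M} |
     [forall a, z a \in Y] && (#|branching_levels B R Y z| <= h)]|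
  <= 2 ^ (t * R) * B ^ h.
Proof.
have ltB n : n %% B < B by rewrite ltn_mod.
pose o0 : 'I_B := Ordinal B_gt0.
pose code (z : {ffun 'I_t -> 'I_M}) :
    {set 'I_t * 'I_R} * {ffun 'I_t * 'I_R -> 'I_B} :=
  let D := branching_levels B R Y z in
  (D, [ffun al => if al \in D then Ordinal (ltB (z al.1 %/ B ^ al.2)) else o0]).
set Z := [set z | _].
have inj_code : {in Z &, injective code}.
  move=> z z' /[!inE] /andP[/forallP zY _] /andP[/forallP z'Y _] [eqD eqf].
  apply: eq_of_branchings => // al alD.
  move/ffunP/(_ al): eqf; rewrite !ffunE -eqD alD => /(congr1 val) /=.
  by [].
rewrite -(card_in_imset inj_code).
pose T := [set D : {set 'I_t * 'I_R} | #|D| <= h].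
pose F (D : {set 'I_t * 'I_R}) :=
  [set Df : {set 'I_t * 'I_R} * {ffun 'I_t * 'I_R -> 'I_B} |
     (Df.1 == D) && (Df.2 \in pffun_on o0 (mem D) predT)].
have subF : code @: Z \subset \bigcup_(D in T) F D.
  apply/subsetP => _ /imsetP[z /[!inE] /andP[_ le_h] ->].
  apply/bigcupP; exists (branching_levels B R Y z); first by rewrite inE.
  rewrite inE eqxx /=; apply/pffun_onP; split=> //.
  by apply/supportP => al /negPf nD; rewrite ffunE nD.
apply: leq_trans (subset_leq_card subF) _.
apply: leq_trans (_ : \sum_(D in T) B ^ h <= _); last first.
  rewrite sum_nat_const leq_mul2r; apply/orP; right.
  have -> : 2 ^ (t * R) = #|{: {set 'I_t * 'I_R}}|.
    by rewrite -cardsT -powersetT card_powerset cardsT card_prod !card_ord.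
  exact: max_card.
apply: (big_ind2 (fun (X : {set _}) m => #|X| <= m)) => [|X m Y' n leX leY|D DT].
- by rewrite cards0.
- by apply: leq_trans (leq_card_setU _ _) _; apply: leq_add.
move: DT; rewrite inE => le_h.
have inj2 : {in F D &, injective snd}.
  by move=> [D1 f1] [D2 f2] /[!inE] /andP[/eqP/= -> _] /andP[/eqP/= -> _] /= ->.
rewrite -(card_in_imset inj2).
apply: leq_trans (_ : #|pffun_on o0 (mem D) (@predT 'I_B)| <= _).
  by apply/subset_leq_card/subsetP => _ /imsetP[p /[!inE] /andP[_ ?] ->].
by rewrite card_pffun_on cardT size_enum_ord leq_pexp2l.
Qed.
End FewBranchings.

(** * Dependent random choice for partite cliques *)

(** Chebyshev's sum inequality for the similarly ordered families d and d ^ n,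
    from (d x - d y) * (d x ^ n - d y ^ n) >= 0 summed over all pairs. *)
Lemma sum_chebyshev (X : finType) (d : X -> nat) n :
  (\sum_x d x) * (\sum_x d x ^ n) <= #|X| * \sum_x d x ^ n.+1.
Proof.
have two x y : d x * d y ^ n + d y * d x ^ n <= d x ^ n.+1 + d y ^ n.+1.
  rewrite !expnS; wlog le_xy : x y / d x <= d y.
    by case: (leqP (d x) (d y)) => [/[swap]|/ltnW le /(_ y x le)]; [apply|lia].
  have le_n : d x ^ n <= d y ^ n by case: (n) => // m; rewrite leq_exp2r.
  nia.
rewrite -(leq_pmul2l (isT : 0 < 2)) !mul2n -!addnn.
have -> : (\sum_x d x) * (\sum_x d x ^ n) = \sum_x \sum_y d x * d y ^ n.
  by rewrite big_distrl; apply: eq_bigr => x _; rewrite big_distrr.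
rewrite {2}exchange_big /= -big_split /=.
have -> : #|X| * \sum_x d x ^ n.+1 = \sum_(x : X) \sum_(y : X) d x ^ n.+1.
  rewrite big_distrr; apply: eq_bigr => x _.
  by rewrite big_const iter_addn_0 mulnC.
rewrite {2}exchange_big /= -big_split /=; apply: leq_sum => x _.
by rewrite -!big_split /=; apply: leq_sum => y _; apply: two.
Qed.

Lemma power_mean (X : finType) (d : X -> nat) n :
  (\sum_x d x) ^ n.+1 <= #|X| ^ n * \sum_x d x ^ n.+1.
Proof.
elim: n => [|n IHn].
  by rewrite expn1 expn0 mul1n; under [leqRHS]eq_bigr do rewrite expn1.
rewrite expnS; apply: leq_trans (leq_mul (leqnn _) IHn) _.
by rewrite mulnCA (expnSr _ n) -mulnA leq_mul2l sum_chebyshev orbT.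
Qed.

Section Cliques.
Variables (M : nat) (e : nat -> 'I_M -> nat -> 'I_M -> bool).

(** A sequence of length k stands for a choice of one vertex in each of the parts
    0, ..., k - 1, in decreasing order of parts: the index of the part of an
    entry is the number of entries after it. *)
Fixpoint joined (s : seq 'I_M) (j : nat) (z : 'I_M) : bool :=
  if s is x :: s' then e (size s') x j z && joined s' j z else true.

Fixpoint clique (U : nat -> {set 'I_M}) (s : seq 'I_M) : bool :=
  if s is x :: s' then
    [&& x \in U (size s'), joined s' (size s') x & clique U s']
  else true.

Definition num_cliques (k : nat) (U : nat -> {set 'I_M}) : nat :=
  #|[set s : k.-tuple 'I_M | clique U s]|.

Definition common_nbrs (t k : nat) (U : nat -> {set 'I_M})
    (z : {ffun 'I_t -> 'I_M}) (i : nat) : {set 'I_M} :=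
  [set x in U i | [forall a, e i x k (z a)]].

Lemma clique_common_nbrs t k (U : nat -> {set 'I_M}) (z : {ffun 'I_t -> 'I_M}) s :
  clique (common_nbrs k U z) s = clique U s && [forall a, joined s k (z a)].
Proof.
elim: s => [|x s IHs] /=; first by symmetry; apply/forallP.
rewrite {}IHs inE; apply/idP/idP.
  case/and3P=> /andP[-> /forallP ex] -> /andP[-> /forallP js] /=.
  by apply/forallP=> a; rewrite ex js.
case/andP=> /and3P[-> -> ->] /forallP ejs /=.
by apply/andP; split; apply/forallP => a; case/andP: (ejs a).
Qed.

Lemma num_cliquesS k (U : nat -> {set 'I_M}) :
  num_cliques k.+1 U =
  \sum_(s : k.-tuple 'I_M | clique U s) #|[set z in U k | joined s k z]|.
Proof.
rewrite /num_cliques -sum1_card.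
rewrite (reindex (fun p : 'I_M * k.-tuple 'I_M => cons_tuple p.1 p.2)) /=; last first.
  exists (fun s : k.+1.-tuple 'I_M => (thead s, behead_tuple s)) => [[z s] _ | s _].
    by congr (_, _); apply/val_inj.
  by apply/val_inj; rewrite /= [in RHS](tuple_eta s).
transitivity (\sum_(s : k.-tuple 'I_M) \sum_(z : 'I_M)
    ((z \in U k) && joined s k z && clique U s : nat)).
  rewrite exchange_big pair_bigA /= [LHS]big_mkcond /=; apply: eq_bigr => -[z s] _ /=.
  by rewrite inE /= size_tuple andbA; case: ifP.
rewrite [RHS]big_mkcond /=; apply: eq_bigr => s _.
rewrite -sum1_card; case: ifP => _; last by apply: big1 => z _; rewrite andbF.
by rewrite [RHS]big_mkcond; apply: eq_bigr => z _; rewrite inE andbT; case: ifP.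
Qed.

Lemma sum_num_cliques t k (U : nat -> {set 'I_M}) :
  \sum_(z : {ffun 'I_t -> 'I_M} | [forall a, z a \in U k])
     num_cliques k (common_nbrs k U z) =
  \sum_(s : k.-tuple 'I_M | clique U s) #|[set z in U k | joined s k z]| ^ t.
Proof.
transitivity (\sum_(z : {ffun 'I_t -> 'I_M}) \sum_(s : k.-tuple 'I_M | clique U s)
   ([forall a, z a \in [set z in U k | joined s k z]] : nat)).
  rewrite [LHS]big_mkcond /=; apply: eq_bigr => z _.
  rewrite /num_cliques -sum1_card; case: ifP => [zU|/forallP zU].
    rewrite [LHS]big_mkcond [RHS]big_mkcond; apply: eq_bigr => s _.
    rewrite inE clique_common_nbrs; case: (clique U s) => //=.
    case: forallP => js; case: forallP => js' //=; last 1 first.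
      by case: js => a; have := js' a; rewrite inE => /andP[].
    by case: js' => a; rewrite inE js (forallP zU).
  rewrite big1 // => s _; case: forallP => // js.
  by case: zU => a; have := js a; rewrite inE => /andP[].
rewrite exchange_big; apply: eq_bigr => s _.
transitivity #|ffun_on (mem [set z in U k | joined s k z]) : pred {ffun 'I_t -> 'I_M}|.
  rewrite -sum1_card [RHS]big_mkcond; apply: eq_bigr => z _.
  case: forallP => [zs|zs]; case: ffun_onP => // zs'.
by rewrite card_ffun_on card_ord.
Qed.

(** Convexity: the average over anchor vectors of the number of cliques in the
    common neighbourhood is at least what it would be if all k-cliques had the
    same number of extensions. *)
Lemma sum_num_cliques_ge t k q (U : nat -> {set 'I_M}) :
  M ^ k.+1 <= q * num_cliques k.+1 U ->
  M ^ k * M ^ t.+1 <=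
  q ^ t.+1 * \sum_(z : {ffun 'I_t.+1 -> 'I_M} | [forall a, z a \in U k])
                num_cliques k (common_nbrs k U z).
Proof.
move=> dense; have [M0|M_gt0] := posnP M.
  have -> : M ^ t.+1 = 0 by rewrite M0 exp0n.
  by rewrite muln0.
rewrite sum_num_cliques.
have pm := @power_mean (k.-tuple 'I_M) (fun s =>
   if clique U s then #|[set z in U k | joined s k z]| else 0) t.
rewrite -big_mkcond -num_cliquesS card_tuple card_ord in pm.
rewrite -(@leq_pmul2l ((M ^ k) ^ t)) ?expn_gt0 ?M_gt0 //.
have -> : (M ^ k) ^ t * (M ^ k * M ^ t.+1) = (M ^ k.+1) ^ t.+1.
  by rewrite mulnA -expnSr -expnMn -expnSr.
have dense' : (M ^ k.+1) ^ t.+1 <= (q * num_cliques k.+1 U) ^ t.+1.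
  by rewrite leq_exp2r.
apply: leq_trans dense' _.
rewrite expnMn mulnCA leq_mul2l; apply/orP; right; apply: leq_trans pm _.
rewrite leq_mul2l [leqRHS]big_mkcond; apply/orP; right.
by apply: leq_sum => s _; case: ifP => // _; rewrite exp0n.
Qed.

Lemma num_cliques_le k (U : nat -> {set 'I_M}) : num_cliques k U <= M ^ k.
Proof. by apply: leq_trans (max_card _) _; rewrite card_tuple card_ord. Qed.

(** If every admissible anchor vector met a bad s or left few cliques, then
    charging M ^ k cliques to each bad pair (s, z) would contradict the
    average of sum_num_cliques_ge. *)
Lemma dependent_random_choice t k q (U : nat -> {set 'I_M}) (S : finType) (N : S -> {set 'I_M})
    (bad : S -> pred {ffun 'I_t.+1 -> 'I_M}) b :
  M ^ k.+1 <= q * num_cliques k.+1 U ->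
  (forall s, #|[set z : {ffun 'I_t.+1 -> 'I_M} |
                 [forall a, z a \in N s] && bad s z]| <= b) ->
  2 * q ^ t.+1 * (#|S| * b) < M ^ t.+1 ->
  exists z : {ffun 'I_t.+1 -> 'I_M},
    [/\ forall a, z a \in U k,
        M ^ k <= 2 * q ^ t.+1 * num_cliques k (common_nbrs k U z)
      & forall s, (forall a, z a \in N s) -> ~~ bad s z].
Proof.
move=> dense few small.
pose Z := {ffun 'I_t.+1 -> 'I_M}.
pose inU (z : Z) := [forall a, z a \in U k].
pose isbad (z : Z) := [exists s, [forall a, z a \in N s] && bad s z].
have [|none] := boolP [exists z : Z, [&& inU z, ~~ isbad z &
    M ^ k <= 2 * q ^ t.+1 * num_cliques k (common_nbrs k U z)]].
  case/existsP=> z /and3P[/forallP zU nb ge]; exists z; split=> // s /forallP zN.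
  by move: nb; rewrite negb_exists => /forallP/(_ s); rewrite zN.
have sum_ge := sum_num_cliques_ge t dense.
suff : 2 * (M ^ k * M ^ t.+1) < 2 * (M ^ k * M ^ t.+1) by rewrite ltnn.
have M_gt0 : 0 < M by case: (posnP M) small => // ->; rewrite exp0n.
apply: leq_ltn_trans (_ : M ^ k * M ^ t.+1 + 2 * q ^ t.+1 * (M ^ k * (#|S| * b)) < _); last first.
  rewrite [ltnRHS]mul2n -addnn ltn_add2l mulnCA ltn_pmul2l //.
  by rewrite expn_gt0 M_gt0.
apply: leq_trans (leq_mul (leqnn 2) sum_ge) _; rewrite mulnA.
have card_bad : \sum_(z : Z) isbad z <= #|S| * b.
  apply: leq_trans (_ : \sum_(z : Z) \sum_(s : S) [forall a, z a \in N s] && bad s z <= _).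
    apply: leq_sum => z _; rewrite /isbad; case: existsP => // -[s sP].
    by rewrite (bigD1 s) //= sP.
  rewrite exchange_big -sum_nat_const; apply: leq_sum => s _.
  apply: leq_trans (few s); rewrite -sum1_card [leqRHS]big_mkcond.
  by apply: leq_sum => z _; rewrite inE; case: ifP.
have -> : M ^ k * M ^ t.+1 = \sum_(z : Z) M ^ k.
  by rewrite sum_nat_const card_ffun !card_ord mulnC.
apply: leq_trans (_ : _ <= \sum_(z : Z) M ^ k + 2 * q ^ t.+1 * (M ^ k * \sum_(z : Z) isbad z)) _; last first.
  by rewrite leq_add2l !leq_mul2l card_bad !orbT.
rewrite [in leqLHS]big_mkcond !big_distrr -big_split /=; apply: leq_sum => z _.
move: none; rewrite negb_exists => /forallP/(_ z); rewrite -/(inU z).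
case: ifP => [_|_ _]; last by rewrite muln0.
case: (isbad z) => /=; last by rewrite -ltnNge => /ltnW ?; lia.
move=> _; rewrite muln1; apply: leq_trans (leq_addl _ _).
by rewrite leq_mul2l num_cliques_le orbT.
Qed.
End Cliques.

(** The constant 2 ^ R only affects constants depending on R. *)
Lemma least_base R M : 0 < R -> 0 < M -> exists B, [/\ 0 < B, M <= B ^ R & B ^ R <= 2 ^ R * M].
Proof.
move=> R_gt0 M_gt0.
have exB : exists B, M <= B ^ R by exists M; rewrite -{1}(expn1 M) leq_pexp2l.
case: (ex_minnP exB) => B leM minB; exists B.
have B_gt0 : 0 < B by case: B leM {minB} => //; rewrite exp0n // leqNgt M_gt0.
split=> //; have [|] := leqP B 1.
  move=> leB; have -> : B = 1 by apply/eqP; rewrite eqn_leq leB.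
  by rewrite exp1n muln_gt0 expn_gt0.
move=> B_gt1; apply: leq_trans (_ : (2 * B.-1) ^ R <= _).
  by rewrite leq_exp2r //; lia.
rewrite expnMn leq_mul2l; apply/orP; right; rewrite leqNgt; apply/negP => /ltnW /minB.
by lia.
Qed.

Definition place (T I : finType) (M : nat) (p : T -> nat) (phi : T -> 'I_M)
    (tau : {ffun I -> option T}) : {ffun I -> option (nat * 'I_M)} :=
  [ffun i => omap (fun v => (p v, phi v)) (tau i)].

(** Entries None of S impose no condition; they pad tuples to a fixed
    length. *)
Definition common_nbrs_in (D : finType) (M : nat) (e : nat -> 'I_M -> nat -> 'I_M -> bool)
    (k : nat) (Uk : {set 'I_M}) (S : {ffun D -> option (nat * 'I_M)}) : {set 'I_M} :=
  [set w in Uk | [forall d, if S d is Some v then e v.1 v.2 k w else true]].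

(** Here badness of S means branching at at most (t - d.+1) * R of the
    t.+1 * R pairs.  Each S has O(M ^ (t - d.+1)) bad vectors and there are
    O(M ^ d.+1) tuples S, so there are O(M ^ t) bad pairs in total, a proportion
    1 / M of all vectors; this is below q ^ - t.+1 as soon as M is a large
    multiple of q ^ t.+1. *)
Lemma anchors_exist d k t R : d.+1 <= t -> 0 < R ->
  exists C, forall M q (e : nat -> 'I_M -> nat -> 'I_M -> bool) (U : nat -> {set 'I_M}),
  0 < q -> C * q ^ t.+1 < M -> M ^ k.+1 <= q * num_cliques e k.+1 U ->
  exists B (z : {ffun 'I_t.+1 -> 'I_M}),
  [/\ 0 < B, forall a, z a \in U k,
      M ^ k <= 2 * q ^ t.+1 * num_cliques e k (common_nbrs e k U z)
    & forall S : {ffun 'I_d.+1 -> option (nat * 'I_M)},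
        (forall j v, S j = Some v -> v.1 < k /\ v.2 \in common_nbrs e k U z v.1) ->
        (t - d.+1) * R < #|branching_levels B R (common_nbrs_in e k (U k) S) z| ].
Proof.
move=> le_dt R_gt0; pose c := k.+1 ^ d.+1 * (2 ^ (t.+1 * R) * (2 ^ R) ^ (t - d.+1)).
exists (2 * c) => M q e U q_gt0 ltM dense.
have M_gt0 : 0 < M by apply: leq_ltn_trans ltM.
have [B [B_gt0 leMB leBM]] := least_base R_gt0 M_gt0.
pose lift (S : {ffun 'I_d.+1 -> option ('I_k * 'I_M)}) : {ffun 'I_d.+1 -> option (nat * 'I_M)} :=
  [ffun j => omap (fun v : 'I_k * 'I_M => (val v.1, v.2)) (S j)].
pose N S := common_nbrs_in e k (U k) (lift S).
have [||z [zU dense' good]] := dependent_random_choice (N := N) (t := t)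
  (bad := fun S z => #|branching_levels B R (N S) z| <= (t - d.+1) * R)
  (b := 2 ^ (t.+1 * R) * B ^ ((t - d.+1) * R)) dense.
- by move=> S; apply: card_few_branchings.
- rewrite card_ffun card_option card_prod !card_ord.
  apply: leq_ltn_trans (_ : (2 * c * q ^ t.+1) * M ^ t < _); last first.
    by rewrite mulnC (expnSr M) ltn_pmul2l // expn_gt0 M_gt0.
  have leS : (k * M).+1 ^ d.+1 <= k.+1 ^ d.+1 * M ^ d.+1.
    by rewrite -expnMn leq_exp2r //; lia.
  have leB : B ^ ((t - d.+1) * R) <= (2 ^ R) ^ (t - d.+1) * M ^ (t - d.+1).
    rewrite -expnMn mulnC expnM; case: (t - d.+1) => // n.
    by rewrite leq_exp2r.
  have -> : M ^ t = M ^ d.+1 * M ^ (t - d.+1) by rewrite -expnD subnKC.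
  have := leq_mul leS (leq_mul (leqnn (2 ^ (t.+1 * R))) leB).
  rewrite /c; move: (2 ^ (t.+1 * R)) ((2 ^ R) ^ _) (M ^ (t - _)) (M ^ d.+1) (k.+1 ^ _) (q ^ _).
  move=> a1 a2 a3 a4 a5 a6 le; rewrite [leqRHS](_ : _ = 2 * a6 * (a5 * a4 * (a1 * (a2 * a3)))) ?leq_mul2l ?le ?orbT //.
  by nia.
exists B, z; split=> // S inS.
pose S' : {ffun 'I_d.+1 -> option ('I_k * 'I_M)} :=
  [ffun j => obind (fun v : nat * 'I_M => omap (fun i => (i, v.2)) (insub v.1)) (S j)].
have ES : lift S' = S.
  apply/ffunP => j; rewrite !ffunE; case Sj: (S j) => [[i x]|] //=.
  by have [/= lti _] := inS _ _ Sj; rewrite insubT.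
rewrite ltnNge -ES; apply: good => a.
rewrite inE zU /= ES; apply/forallP => j; case Sj: (S j) => [v|] //.
by have [_] := inS _ _ Sj; rewrite inE => /andP[_ /forallP].
Qed.

(** * Embedding a multipartite graph with few colors *)

Lemma card_setC_bigcap (X P : finType) (K : {set X}) (F : X -> {set P}) n :
  (forall x, x \in K -> #|~: F x| <= n) -> #|~: \bigcap_(x in K) F x| <= #|K| * n.
Proof.
move=> leF; rewrite setC_bigcap -sum_nat_const.
apply: (big_ind2 (fun (A : {set _}) m => #|A| <= m)) => [|A m B m' leA leB|x xK].
- by rewrite cards0.
- by apply: leq_trans (leq_card_setU _ _) _; apply: leq_add.
exact: leF.
Qed.

Lemma common_anchor (t R r : nat) (X : {set 'I_t * 'I_R}) :
  0 < t -> t * r <= #|X| -> exists a, r <= #|[set l | (a, l) \in X]|.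
Proof.
move=> t_gt0 leX; apply/existsP; apply: contraLR leX.
rewrite negb_exists => /forallP lt; rewrite -ltnNge.
have -> : #|X| = \sum_a #|[set l | (a, l) \in X]|.
  transitivity (\sum_a \sum_l ((a, l) \in X : nat)).
    rewrite pair_bigA -sum1_card big_mkcond; apply: eq_bigr => -[a l] _ /=.
    by case: ifP.
  apply: eq_bigr => a _; rewrite -sum1_card [RHS]big_mkcond.
  by apply: eq_bigr => l _; rewrite inE; case: ifP.
have [r0|r_gt0] := posnP r.
  by have := lt (Ordinal t_gt0); rewrite r0.
apply: leq_ltn_trans (_ : t * r.-1 < _); last by rewrite ltn_pmul2l // prednK.
have -> : t * r.-1 = \sum_(a : 'I_t) r.-1 by rewrite sum_nat_const card_ord.
apply: leq_sum => a _.
by have := lt a; rewrite -ltnNge -{1}(prednK r_gt0) ltnS.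
Qed.

Section Copies.
Variables (d : nat) (T : finType) (p rk : T -> nat) (m : nat) (E : rel T).

Definition earlier_nbrs (v : T) : {set T} := [set u | E u v && (p u < p v)].

(** The earlier neighbours of v as a tuple of fixed length, padded with None. *)
Definition earlier_tuple (v : T) : {ffun 'I_d.+1 -> option T} :=
  [ffun j : 'I_d.+1 => onth (enum (earlier_nbrs v)) j].

Lemma earlier_tupleP v u j : earlier_tuple v j = Some u -> E u v && (p u < p v).
Proof.
rewrite ffunE => uj; have /onthP : exists i, onth (enum (earlier_nbrs v)) i = Some u.
  by exists (val j).
by rewrite mem_enum inE.
Qed.

Lemma mem_earlier_tuple v u : #|earlier_nbrs v| <= d.+1 ->
  E u v -> p u < p v -> exists j, earlier_tuple v j = Some u.
Proof.
move=> le_d Euv ltp; have /onthP[i ui] : u \in enum (earlier_nbrs v).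
  by rewrite mem_enum inE Euv.
have lti : i < d.+1.
  by apply: leq_trans le_d; rewrite cardE -onthTE ui.
by exists (Ordinal lti); rewrite ffunE.
Qed.
End Copies.

(** A copy of the parts below k.  The map rk gives the order of vertices inside
    each part; only the order inside a part is at stake, since different parts
    go to different intervals. *)
Definition is_copy (k : nat) (T : finType) (p rk : T -> nat) (E : rel T) (M : nat)
    (e : nat -> 'I_M -> nat -> 'I_M -> bool) (U : nat -> {set 'I_M}) (phi : T -> 'I_M) : Prop :=
  [/\ forall v, p v < k -> phi v \in U (p v),
      forall u v, p u = p v -> p v < k -> rk u < rk v -> phi u < phi v
    & forall u v, p u < p v -> p v < k -> E u v -> e (p u) (phi u) (p v) (phi v)].

Definition few_colored (k s : nat) (T I C : finType) (p : T -> nat) (M : nat)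
    (chi : {ffun I -> option (nat * 'I_M)} -> C) (phi : T -> 'I_M) : Prop :=
  exists2 K : {set C}, #|K| <= s &
  forall tau : {ffun I -> option T}, (forall i v, tau i = Some v -> p v < k) ->
  chi (place p phi tau) \in K.

(** Induction on the number k of parts.  The coloring chi is what makes the
    induction work: see the step that defines chi'.  The order of quantifiers
    matters: s and f come before H and the number of colors C, the constant c
    after. *)
Lemma copies_exist (d k : nat) (I : finType) : exists s f,
  forall (T : finType) (p rk : T -> nat) (m : nat) (E : rel T) (C : finType),
  (forall v, rk v < m) -> (forall v, #|earlier_nbrs p E v| <= d.+1) ->
  exists c, forall M q (e : nat -> 'I_M -> nat -> 'I_M -> bool) (U : nat -> {set 'I_M})
    (chi : {ffun I -> option (nat * 'I_M)} -> C),
  0 < q -> c * q ^ f <= M -> M ^ k <= q * num_cliques e k U ->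
  exists2 phi : T -> 'I_M, is_copy k p rk E e U phi & few_colored k s p chi phi.
Proof.
elim: k I => [|k IHk] I.
  exists 1, 0 => T p rk m E C _ _; exists 1 => M q e U chi _ M_gt0 _.
  exists (fun _ => Ordinal M_gt0); first by split.
  exists [set chi [ffun=> None]]; first by rewrite cards1.
  move=> tau tau0; rewrite inE; apply/eqP; congr chi; apply/ffunP => i.
  by rewrite !ffunE; case Ei: (tau i) => [v|] //; have := tau0 _ _ Ei.
(* An I-tuple of parts up to k is encoded by a tuple of parts below k: the block
   of d.+1 entries at Some i describes the i-th entry, either as itself or, if it
   lies in part k, by its earlier neighbours.  The block at None is there to
   show the type of a single vertex of part k. *)
have [s [f IH]] := IHk (option I * 'I_d.+1)%type.
(* At most s types, each missing less than d.+2 * R of the t.+1 * R pairs, have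
   at least R pairs in common: t.+1 exceeds s * d.+2. *)
pose t := s.+1 * d.+2.
exists (#|{ffun I -> 'I_#|I|}| * (s * 2 ^ #|I|)), (t.+1 * f.+1) => T p rk m E C ltm degE.
(* The colors of levels refer to the s surviving colors of chi' by index, as the
   number of all colors of chi' depends on R, hence on L. *)
have [L HL] := few_colors I {ffun 'I_s * {ffun I -> bool} -> C} m.+1.
pose R := t.+1 * L.+1.
pose P := ('I_t.+1 * 'I_R)%type.
have R_gt0 : 0 < R by [].
have le_dt : d.+1 <= t by rewrite /t; nia.
have [c1 anchors] := anchors_exist k le_dt R_gt0.
have [c2 {}IH] := IH T p rk m E ({set P} * {ffun {ffun I -> option P} -> C})%type ltm degE.
exists (c1.+1 + c2 * 2 ^ f) => M q e U chi q_gt0 leM dense.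
have [ltM1 leM2] : c1 * q ^ t.+1 < M /\ c2 * (2 * q ^ t.+1) ^ f <= M.
  have Eq : q ^ (t.+1 * f.+1) = q ^ t.+1 * (q ^ t.+1) ^ f by rewrite -expnS expnM.
  have q1 : 0 < q ^ t.+1 by rewrite expn_gt0 q_gt0.
  have q2 : 0 < (q ^ t.+1) ^ f by rewrite expn_gt0 q1.
  move: leM; rewrite Eq expnMn; move: (q ^ _) ((q ^ _) ^ f) (2 ^ f) q1 q2 => x y w x0 y0 le.
  by split; nia.
have [B [z [B_gt0 zU dense' good]]] := anchors M q e U q_gt0 ltM1 dense.
pose U' := common_nbrs e k U z.
pose N (S : {ffun 'I_d.+1 -> option (nat * 'I_M)}) := common_nbrs_in e k (U k) S.
pose typ S := branching_levels B R (N S) z.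
(* A chosen vertex of part k for the tuple S and the pair al; the default is
   used only at pairs outside the type of S. *)
pose cand S (al : P) := odflt (z al.1) [pick w in N S | branches B al.2 (z al.1) w].
have candP S al : al \in typ S ->
    cand S al \in N S /\ branches B al.2 (z al.1) (cand S al).
  rewrite inE /cand => /exists_inP[w wN br]; case: pickP => [w' /andP[]//|/(_ w)].
  by rewrite wN br.
pose blk (sigma : {ffun option I * 'I_d.+1 -> option (nat * 'I_M)}) o :=
  [ffun j : 'I_d.+1 => sigma (o, j)].
(* The color of an encoded tuple is the type of its block None together with the
   chi-colors of all tuples that it can stand for: g says which entries lie in
   part k, and at which pairs they are placed. *)
pose chi' sigma : {set P} * {ffun {ffun I -> option P} -> C} :=
  (typ (blk sigma None), [ffun g : {ffun I -> option P} => chi [ffun i =>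
     if g i is Some al then Some (k, cand (blk sigma (Some i)) al)
     else sigma (Some i, ord0)]]).
have [|phi [phiU phi_lt phi_e] [K leK phiK]] := IH M (2 * q ^ t.+1) e U' chi' _ leM2 dense'.
  by rewrite muln_gt0 expn_gt0 q_gt0.
pose S v := place p phi (earlier_tuple d p E v).
have big_typ v : p v = k -> (t - d.+1) * R < #|typ (S v)|.
  move=> pv; apply: good => j [i x]; rewrite ffunE.
  case Ej: (earlier_tuple _ _ _ _ _) => [u|] //= [<- <-].
  have /andP[_ ltp] := earlier_tupleP Ej; rewrite pv in ltp.
  by split=> //; apply: phiU.
pose tau' (tau : {ffun I -> option T}) (w : option T) :
    {ffun option I * 'I_d.+1 -> option T} :=
  [ffun oj => if oj.1 is Some i then
      obind (fun v => if p v == k then earlier_tuple d p E v oj.2 else Some v) (tau i)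
    else obind (fun v => earlier_tuple d p E v oj.2) w].
have tau'K (tau : {ffun I -> option T}) w : (forall i v, tau i = Some v -> p v < k.+1) ->
    (forall v, w = Some v -> p v = k) -> chi' (place p phi (tau' tau w)) \in K.
  move=> tauk wk; apply: phiK => -[[i|] j] v; rewrite ffunE /=.
    case Ei: (tau i) => [u|] //=; case: eqP => [pu|/eqP pu [<-]].
      by move/earlier_tupleP => /andP[_]; rewrite pu.
    by have := tauk _ _ Ei; rewrite ltnS leq_eqVlt (negPf pu).
  by case: w wk => [u|] //= /(_ u erefl) <- /earlier_tupleP/andP[].
have blk_earlier (tau : {ffun I -> option T}) v o : p v = k ->
    (if o is Some i then tau i else Some v) = Some v ->
    blk (place p phi (tau' tau (Some v))) o = S v.
  move=> pv Eo; apply/ffunP => j; rewrite !ffunE /=.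
  by case: o Eo => [i ->|_] /=; rewrite ?pv ?eqxx ffunE.
pose K1 := [set g in K | (t - d.+1) * R < #|g.1|].
pose X := \bigcap_(g in K1) g.1.
have cardX : t.+1 * L.+1 <= #|X|.
  have cP : #|{: P}| = t.+1 * R by rewrite card_prod !card_ord.
  have leC : #|~: X| <= s * (d.+2 * R).
    apply: leq_trans (card_setC_bigcap (n := d.+2 * R) _) _.
      move=> g /[!inE] /andP[_ lt_g]; have := cardsC g.1; rewrite cP.
      move: lt_g; have -> : t.+1 * R = (t - d.+1) * R + d.+2 * R.
        by rewrite -mulnDl; congr (_ * _); lia.
      by lia.
    rewrite leq_mul2r; apply/orP; right; apply: leq_trans leK.
    by apply/subset_leq_card/subsetP => g /[!inE] /andP[].
  have le_t : s * (d.+2 * R) <= t * R by rewrite mulnA leq_mul2r /t mulSn leq_addl orbT.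
  have := cardsC X; rewrite cP mulSn -/R => cX.
  by rewrite -(leq_add2r #|~: X|) cX leq_add2l; apply: leq_trans le_t.
(* All vertices of part k use the same anchor, since levels at different anchors
   are not comparable. *)
have [a leY0] := common_anchor (ltn0Sn t) cardX.
set Y0 := [set l | _] in leY0.
have typX v : p v = k -> X \subset typ (S v).
  move=> pv; pose g := chi' (place p phi (tau' [ffun=> None] (Some v))).
  have Eg : g.1 = typ (S v) by rewrite /g /= blk_earlier.
  have gK : g \in K by apply: tau'K => [i u|u [<-]] //; rewrite ffunE.
  rewrite -Eg; apply: (bigcap_inf g); rewrite inE gK Eg; exact: big_typ.
pose g0 : {set P} * {ffun {ffun I -> option P} -> C} :=
  chi' (place p phi (tau' [ffun=> None] None)).
pose slot (beta : {ffun I -> bool}) (x : {ffun I -> 'I_R}) : {ffun I -> option P} :=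
  [ffun i => if beta i then Some (a, x i) else None].
pose col (x : {ffun I -> 'I_R}) : {ffun 'I_s * {ffun I -> bool} -> C} :=
  [ffun jb : 'I_s * {ffun I -> bool} => (nth g0 (enum K) jb.1).2 (slot jb.2 x)].
have [Y [K2 [sYY0 leY leK2 colK2]]] := HL R Y0 col (ltnW leY0).
have [l0 l0Y] : exists l0, l0 \in Y by apply/set0Pn; rewrite -card_gt0; apply: leq_trans leY.
(* Y has more elements than any rank, so levels increase with rank. *)
pose lev v := nth l0 (enum Y) (rk v).
have rk_lt v : rk v < size (enum Y).
  by rewrite -cardE; apply: leq_trans leY; apply: ltnW; rewrite ltnS.
have levY v : lev v \in Y by rewrite -mem_enum mem_nth.
have lev_typ v : p v = k -> (a, lev v) \in typ (S v).
  move=> pv; apply: (subsetP (typX v pv)).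
  by have := subsetP sYY0 _ (levY v); rewrite inE.
have lev_lt u v : rk u < rk v -> lev u < lev v.
  move=> lt_uv; pose ltO := relpre (@nat_of_ord R) ltn.
  have trO : transitive ltO by move=> y x w /=; apply: ltn_trans.
  have srt : sorted ltO (enum Y).
    apply: (subseq_sorted trO (enum_subseq (subsetT Y))).
    by rewrite enum_setT -enumT -sorted_map val_enum_ord iota_ltn_sorted.
  exact: (sorted_ltn_nth trO l0 srt _ _ (rk_lt u) (rk_lt v) lt_uv).
pose phi' v := if p v == k then cand (S v) (a, lev v) else phi v.
have phi'k v : p v = k -> phi' v = cand (S v) (a, lev v) by rewrite /phi' => ->; rewrite eqxx.
have phi'n v : p v < k -> phi' v = phi v by rewrite /phi'; case: ltngtP.
exists phi'; first split.
- move=> v; rewrite ltnS leq_eqVlt => /predU1P[pv|pv].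
    rewrite phi'k // pv; have [+ _] := candP _ _ (lev_typ v pv).
    by rewrite inE => /andP[].
  by rewrite phi'n //; have := phiU v pv; rewrite inE => /andP[].
- move=> u v Ep; rewrite ltnS leq_eqVlt => /predU1P[pv|pv] lt_uv; last first.
    by rewrite !phi'n ?Ep //; apply: phi_lt.
  have pu : p u = k by rewrite Ep.
  have [_ bu] := candP _ _ (lev_typ u pu); have [_ bv] := candP _ _ (lev_typ v pv).
  by rewrite !phi'k //; apply: branches_lt bu bv => //; apply: lev_lt.
- move=> u v ltp; rewrite ltnS leq_eqVlt => /predU1P[pv|pv] Euv; last first.
    by rewrite !phi'n ?(ltn_trans ltp) //; apply: phi_e.
  have [j Ej] := mem_earlier_tuple (degE v) Euv ltp.
  have [+ _] := candP _ _ (lev_typ v pv); rewrite inE => /andP[_ /forallP/(_ j)].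
  by rewrite ffunE Ej /= (phi'k v) // (phi'n u) -?pv.
pose G := ({ffun 'I_s * {ffun I -> bool} -> C} * ('I_s * {ffun I -> bool}))%type.
exists [set (g : G).1 g.2 | g in setX K2 [set: 'I_s * {ffun I -> bool}]].
  apply: leq_trans (leq_imset_card _ _) _; rewrite cardsX cardsT card_prod card_ord.
  by rewrite card_ffun card_bool leq_mul2r leK2 orbT.
move=> tau tauk; pose sigma := place p phi (tau' tau None).
have sigmaK : chi' sigma \in K by apply: tau'K.
pose beta := [ffun i => if tau i is Some v then p v == k else false].
pose x := [ffun i => if tau i is Some v then lev v else l0].
have lt_s : index (chi' sigma) (enum K) < s.
  by apply: leq_trans leK; rewrite cardE index_mem mem_enum.
(* The color of tau is determined by the color of its encoding among the at most
   s elements of K, by the set beta of entries in part k, and by the color of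
   the levels x. *)
apply/imsetP; exists (col x, (Ordinal lt_s, beta)).
  rewrite !inE andbT; apply: colK2 => i; rewrite ffunE.
  by case: (tau i).
rewrite !ffunE /= nth_index ?mem_enum // ffunE; congr chi; apply/ffunP => i.
rewrite [LHS]ffunE [RHS]ffunE ffunE [beta i]ffunE [x i]ffunE.
case Ei: (tau i) => [v|] /=; last by rewrite !ffunE /= Ei.
case: eqP => pv /=.
  rewrite phi'k // pv; congr (Some (_, cand _ _)).
  by apply/ffunP => j; rewrite !ffunE /= Ei /= pv eqxx ffunE.
have ltv : p v < k by have := tauk _ _ Ei; rewrite ltnS leq_eqVlt => /predU1P[].
by rewrite !ffunE /= Ei /= (negPf (introN eqP pv)) /= phi'n.
Qed.

(** * From colorings of complete graphs to dense intervals *)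

(** The Erdos-Szekeres recursion, with n ^ k in place of the binomial
    coefficient: n.+1 ^ k + n ^ k.+1 <= n.+1 ^ k.+1.  The induction is on a bound
    of k + n. *)
Lemma ramsey_clique (A : eqType) (r : rel A) k n (s : seq A) : n ^ k <= size s ->
  exists2 z, subseq z s &
    (size z = k /\ pairwise r z) \/
    (size z = n /\ pairwise (fun x y => ~~ r x y) z).
Proof.
have [j le_j] : exists j, k + n <= j by exists (k + n).
elim: j k n s le_j => [|j IHj] [|k] [|n] s lej les;
  try by exists [::]; [exact: sub0seq | by [left | right]].
case: s les => [|x s] les; first by rewrite leqn0 expn_eq0 in les.
have szF : size s = count (r x) s + count (fun y => ~~ r x y) s.
  by rewrite count_predC.
have pow : n.+1 ^ k + n ^ k.+1 <= n.+1 ^ k.+1.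
  rewrite (expnS n.+1) mulSn leq_add2l expnS leq_mul2l; apply/orP; right.
  by case: (k) => // k'; rewrite leq_exp2r.
have [le_r|lt_r] := leqP (n.+1 ^ k) (count (r x) s).
  have [||z subz zP] := IHj k n.+1 (filter (r x) s); rewrite ?size_filter //.
  have subs := subseq_trans subz (filter_subseq _ s).
  case: zP => [[szz prz]|zP]; last by exists z; [exact: subseq_trans subs (subseq_cons _ _) | right].
  exists (x :: z); first by rewrite /= eqxx.
  left; rewrite /= szz prz andbT; split=> //; apply/allP => y /(mem_subseq subz).
  by rewrite mem_filter => /andP[].
have [||z subz zP] := IHj k.+1 n (filter (fun y => ~~ r x y) s); rewrite ?size_filter; first by lia.
  by move: les pow => /=; lia.
have subs := subseq_trans subz (filter_subseq _ s).
case: zP => [zP|[szz prz]]; first by exists z; [exact: subseq_trans subs (subseq_cons _ _) | left].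
exists (x :: z); first by rewrite /= eqxx.
right; rewrite /= szz prz andbT; split=> //; apply/allP => y /(mem_subseq subz).
by rewrite mem_filter => /andP[].
Qed.

Lemma exists_large_term (X : finType) (P : pred X) (F : X -> nat) n :
  0 < n -> n <= \sum_(x | P x) F x -> exists2 x, P x & n <= #|X| * F x.
Proof.
move=> n_gt0 len.
suff /exists_inP[x Px lex] : [exists (x | P x), n <= #|X| * F x] by exists x.
apply: contraLR len; rewrite negb_exists_in => /forall_inP lt; rewrite -ltnNge.
have [X0|X_gt0] := posnP #|X|.
  by rewrite big1 // => x; move: (card0_eq X0 x); rewrite inE.
rewrite -(ltn_pmul2l X_gt0) big_distrr /=.
apply: leq_ltn_trans (_ : #|X| * n.-1 < _); last by rewrite ltn_pmul2l // prednK.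
rewrite -sum_nat_const [leqLHS]big_mkcond; apply: leq_sum => x _.
by case: ifP => // /lt; rewrite -ltnNge -{1}(prednK n_gt0) ltnS.
Qed.

(** Restricting a transversal to the intervals in J has fibres of size
    M ^ (L - k). *)
Lemma card_transversals L M k (J : k.-tuple 'I_L) (P : pred (k.-tuple 'I_M)) :
  0 < M -> uniq J ->
  #|[set x : {ffun 'I_L -> 'I_M} | P [tuple of map x J]]| * M ^ k
  <= #|[set y | P y]| * M ^ L.
Proof.
move=> M_gt0 uJ; pose x0 := Ordinal M_gt0.
pose code (x : {ffun 'I_L -> 'I_M}) :=
  ([tuple of map x J], [ffun l => if l \in J then x0 else x l]).
have inj_code : injective code.
  move=> x x' [eqJ eqC]; apply/ffunP => l.
  have [lJ|/negPf lJ] := boolP (l \in J).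
    by move/eq_in_map: eqJ; apply.
  by move/ffunP: eqC => /(_ l); rewrite !ffunE lJ.
rewrite -(card_imset _ inj_code).
have cJ : #|[predC J]| + k = L.
  by rewrite -[RHS](card_ord L) -(cardC (mem J)) (card_uniqP uJ) size_tuple addnC.
have -> : M ^ L = M ^ #|[predC J]| * M ^ k by rewrite -expnD cJ.
rewrite mulnA leq_mul2r; apply/orP; right.
apply: leq_trans (_ : #|setX [set y | P y] [set f in pffun_on x0 [predC J] (@predT 'I_M)]| <= _).
  apply/subset_leq_card/subsetP => _ /imsetP[x + ->].
  rewrite inE => Px; rewrite in_setX inE Px in_set; apply/pffun_onP; split=> //.
  by apply/supportP => l; rewrite inE negbK /= ffunE => ->.
by rewrite cardsX [X in _ * X]cardsE card_pffun_on cardT size_enum_ord.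
Qed.

Section Transversal.
Variables (M : nat) (e : nat -> 'I_M -> nat -> 'I_M -> bool).

Lemma joined_rev_mkseq (f : nat -> 'I_M) k j z : (forall i, i < k -> e i (f i) j z) ->
  joined e (rev (mkseq f k)) j z.
Proof.
elim: k => [|k IHk] // ek; rewrite mkseqS rev_rcons /= size_rev size_mkseq ek //=.
by apply: IHk => i ltik; apply/ek/ltnW.
Qed.

Lemma clique_rev_mkseq (f : nat -> 'I_M) k :
  (forall i j, i < j -> j < k -> e i (f i) j (f j)) ->
  clique e (fun=> setT) (rev (mkseq f k)).
Proof.
elim: k => [|k IHk] // ek; rewrite mkseqS rev_rcons /= in_setT size_rev size_mkseq /=.
rewrite joined_rev_mkseq => [|i ltik]; last exact: ek.
by apply: IHk => i j ltij ltjk; apply/ek/ltnW.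
Qed.
End Transversal.

(** Some J serves at least a fraction L ^ -k of all transversals x.  The witness
    x in the conclusion only transfers to J the part of r that does not depend
    on the vertices, such as the order of the intervals. *)
Lemma dense_intervals L M k (r : rel ('I_L * 'I_M)) (l0 : 'I_L) : 0 < M ->
  (forall x : {ffun 'I_L -> 'I_M}, exists2 J : k.-tuple 'I_L, uniq J &
     pairwise (fun l l' => r (l, x l) (l', x l')) J) ->
  exists2 J : k.-tuple 'I_L,
    exists x : {ffun 'I_L -> 'I_M}, pairwise (fun l l' => r (l, x l) (l', x l')) J &
    M ^ k <= L ^ k *
      num_cliques (fun i x j y => r (nth l0 J i, x) (nth l0 J j, y)) k (fun=> setT).
Proof.
move=> M_gt0 exJ; pose e (J : k.-tuple 'I_L) i x j y := r (nth l0 J i, x) (nth l0 J j, y).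
pose good (J : k.-tuple 'I_L) : {set {ffun 'I_L -> 'I_M}} :=
  [set x : {ffun 'I_L -> 'I_M} | pairwise (fun l l' => r (l, x l) (l', x l')) J].
have pos_ML : 0 < M ^ L by rewrite expn_gt0 M_gt0.
have [|J uJ leJ] := @exists_large_term _ (fun J : k.-tuple 'I_L => uniq J)
    (fun J => #|good J|) (M ^ L) pos_ML.
  apply: leq_trans (_ : \sum_(x : {ffun 'I_L -> 'I_M}) \sum_(J : k.-tuple 'I_L | uniq J)
     (x \in good J) <= _).
    have -> : M ^ L = \sum_(x : {ffun 'I_L -> 'I_M}) 1.
      by rewrite sum1_card card_ffun !card_ord.
    apply: leq_sum => x _; have [J uJ Jx] := exJ x.
    by rewrite (bigD1 J) //= inE Jx.
  rewrite exchange_big; apply: leq_sum => J _.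
  by rewrite -sum1_card [leqRHS]big_mkcond; apply: leq_sum => x _; case: ifP.
rewrite card_tuple card_ord in leJ.
exists J.
  have : 0 < #|good J| by move: leJ; case: #|good J| => //; rewrite muln0 leqNgt pos_ML.
  by case/card_gt0P => x /[!inE]; exists x.
rewrite -(leq_pmul2r pos_ML) -mulnA; apply: leq_trans (_ : L ^ k * (#|good J| * M ^ k) <= _).
  by rewrite mulnC mulnA leq_mul2r leJ orbT.
rewrite leq_mul2l; apply/orP; right.
apply: leq_trans (leq_trans (card_transversals
    (fun y : k.-tuple 'I_M => clique (e J) (fun=> setT) (rev y)) M_gt0 uJ) _).
  rewrite leq_mul2r; apply/orP; right; apply/subset_leq_card/subsetP => x.
  rewrite !inE /= => /(pairwiseP l0) Jx.
  have -> : map x J = mkseq (fun i => x (nth l0 J i)) k.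
    by rewrite -[in LHS](mkseq_nth l0 J) size_tuple /mkseq -map_comp.
  apply: clique_rev_mkseq => i j ltij ltjk; apply: Jx => //; rewrite inE size_tuple //.
  exact: ltn_trans ltjk.
rewrite leq_mul2r; apply/orP; right; rewrite /num_cliques.
have rev_inj : injective (fun y : k.-tuple 'I_M => [tuple of rev y]).
  by move=> y y' /(congr1 val) /= /(congr1 rev); rewrite !revK => /val_inj.
rewrite -(card_imset _ rev_inj); apply/subset_leq_card/subsetP => _ /imsetP[y + ->].
by rewrite !inE.
Qed.

(** Number the classes of an optimal interval coloring from the bottom: the part
    of v is the number of classes that start below v and do not contain it. *)
Lemma interval_parts (H : ordered_graph) : exists p : H -> nat,
  [/\ forall v, p v < interval_chromatic_number H,
      forall u v, (u <= v)%O -> p u <= p v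
    & forall u v, p u = p v -> ~~ edge u v].
Proof.
have [[P /andP[partP intP] <-] _] := interval_chromatic_numberP H.
have [/eqP covP trivP _] := and3P partP.
pose below (v : H) := [set A in P | (v \notin A) && [exists a in A, (a < v)%O]].
have pbP v : pblock P v \in P by rewrite pblock_mem // covP inE.
have vpb v : v \in pblock P v by rewrite mem_pblock covP inE.
have intervalP A u v w : A \in P -> u \in A -> w \in A -> (u <= v)%O -> (v <= w)%O -> v \in A.
  move=> AP uA wA le1 le2; have /andP[iA _] := forall_inP intP _ AP.
  move/forall_inP/(_ _ uA)/forall_inP/(_ _ wA)/forallP/(_ v): iA.
  by rewrite le1 le2.
have sub u v : (u <= v)%O -> below u \subset below v.
  move=> le_uv; apply/subsetP => A; rewrite !inE => /and3P[AP uA /exists_inP[a aA lt_a]].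
  rewrite AP /=; apply/andP; split; last first.
    by apply/exists_inP; exists a => //; apply: lt_le_trans lt_a le_uv.
  by apply: contra uA => vA; apply: (intervalP A a u v) => //; apply: ltW.
exists (fun v => #|below v|); split=> [v|u v le_uv|u v eq_uv].
- apply: proper_card; apply/properP; split.
    by apply/subsetP => A; rewrite inE => /andP[].
  by exists (pblock P v) => //; rewrite inE vpb andbF.
- exact/subset_leq_card/sub.
have same a b : (a <= b)%O -> #|below a| = #|below b| -> pblock P a = pblock P b.
  move=> le_ab eq_ab; have Eb : below a = below b.
    by apply/eqP; rewrite eqEcard eq_ab leqnn andbT sub.
  apply: same_pblock => //; apply: contraT => nab.
  have : pblock P a \in below a.
    rewrite Eb inE pbP /= andbC; apply/andP; split.
      apply/exists_inP; exists a => //; rewrite lt_neqAle le_ab andbT.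
      by apply: contraNneq nab => <-.
    by apply: contra nab => bpa; rewrite (def_pblock trivP (pbP a) bpa).
  by rewrite inE vpb andbF.
have Euv : pblock P u = pblock P v.
  by case: (leP u v) => [le|/ltW le]; [apply: same | symmetry; apply: same].
have /andP[_ ind] := forall_inP intP _ (pbP u).
move/forall_inP/(_ _ (vpb u))/forall_inP: ind; apply.
by rewrite Euv.
Qed.

Lemma exists_least (P : nat -> Prop) n : P n ->
  exists2 r, P r /\ (forall i, P i -> r <= i) & r <= n.
Proof.
elim/ltn_ind: n => n IHn Pn.
have [[i [ltin Pi]]|none] := classic (exists i, i < n /\ P i).
  by have [r rP le_r] := IHn i ltin Pi; exists r => //; apply: leq_trans (ltnW ltin).
exists n => //; split=> // i Pi; rewrite leqNgt; apply/negP => ltin.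
by apply: none; exists i.
Qed.

Section Position.
Variables (L M : nat).

Lemma position_subproof (v : 'I_L * 'I_M) : v.1 * M + v.2 < L * M.
Proof.
case: v => l x /=; apply: leq_trans (_ : l.+1 * M <= _).
  by rewrite mulSn addnC ltn_add2r.
by rewrite leq_mul2r ltn_ord orbT.
Qed.

(** Vertex x of interval l among L consecutive intervals of length M. *)
Definition position (v : 'I_L * 'I_M) : 'I_(L * M) := Ordinal (position_subproof v).

Lemma position_lt_interval (l l' : 'I_L) (x x' : 'I_M) : l < l' -> position (l, x) < position (l', x').
Proof.
move=> lt_l /=; apply: leq_trans (_ : l.+1 * M <= _).
  by rewrite mulSn addnC ltn_add2r.
by apply: leq_trans (leq_addr _ _); rewrite leq_mul2r lt_l orbT.
Qed.
End Position.

(** The argument on intervals, with constants: n ^ k intervals of length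
    M = c * q ^ f where q = (n ^ k) ^ k. *)
Lemma polynomial_ramsey_property (d k : nat) : exists f, forall H : ordered_graph,
  max_degree H <= d.+1 -> interval_chromatic_number H <= k ->
  exists c, forall n, 0 < n -> ramsey_property H (complete n) (n ^ k * (c * (n ^ (k * k)) ^ f)).
Proof.
have [s [f copies]] := copies_exist d k void; exists f => H degH chiH.
have [p [p_lt p_le p_edge]] := interval_parts H.
pose rk (v : H) := #|[set u : H | (u < v)%O]|.
have rk_lt u v : (u < v)%O -> rk u < rk v.
  move=> lt_uv; apply: proper_card; apply/properP; split.
    by apply/subsetP => w; rewrite !inE => lt_wu; apply: lt_trans lt_uv.
  by exists u; rewrite !inE ?ltxx.
have [||c Hc] := copies H p rk #|H|.+1 (@edge H) unit.
- by move=> v; rewrite ltnS max_card.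
- move=> v; apply: leq_trans degH; rewrite /max_degree.
  apply: leq_trans (leq_bigmax v); apply/subset_leq_card/subsetP => u.
  by rewrite !inE edge_sym => /andP[].
exists c.+1 => n n_gt0; set L := n ^ k; set q := n ^ (k * k); set M := c.+1 * q ^ f.
have q_gt0 : 0 < q by rewrite expn_gt0 n_gt0.
have M_gt0 : 0 < M by rewrite muln_gt0 expn_gt0 q_gt0.
have L_gt0 : 0 < L by rewrite expn_gt0 n_gt0.
pose l0 := Ordinal L_gt0.
move=> col; pose red v w := col [set position v; position w] : bool.
pose r (v w : 'I_L * 'I_M) := (v.1 < w.1) && red v w.
have [/forallP exJ|/forallPn[x noJ]] := boolP [forall x : {ffun 'I_L -> 'I_M}, [exists J : k.-tuple 'I_L,
    uniq J && pairwise (fun l l' => r (l, x l) (l', x l')) J]]; [left | right].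
  have [|J [x Jx] dense] := @dense_intervals L M k r l0 M_gt0.
    by move=> x; have /existsP[J /andP[]] := exJ x; exists J.
  have J_lt i j : i < j -> j < k -> nth l0 J i < nth l0 J j.
    move=> ltij ltjk; move/(pairwiseP l0): Jx => /(_ i j); rewrite !inE size_tuple.
    by move=> /(_ (ltn_trans ltij ltjk) ltjk ltij) /andP[].
  pose e i y j y' := r (nth l0 J i, y) (nth l0 J j, y').
  have [||phi [_ phi_lt phi_e] _] := Hc M q e (fun=> setT) (fun=> tt) q_gt0.
  - by rewrite leq_mul2r leqnSn orbT.
  - by rewrite /q expnM; apply: dense.
  have ltk v : p v < k by apply: leq_trans chiH.
  exists (fun v => position (nth l0 J (p v), phi v)); split=> [u v lt_uv|].
    rewrite ltEord; have := p_le u v (ltW lt_uv); rewrite leq_eqVlt => /predU1P[Ep|ltp].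
      by rewrite Ep /= ltn_add2l; apply: phi_lt => //; apply: rk_lt.
    by apply: position_lt_interval; apply: J_lt.
  have edge_lt u v : (u < v)%O -> edge u v ->
      color_edge col true (position (nth l0 J (p u), phi u)) (position (nth l0 J (p v), phi v)).
    move=> lt_uv Euv; have := p_le u v (ltW lt_uv); rewrite leq_eqVlt => /predU1P[Ep|ltp].
      by have := p_edge u v Ep; rewrite Euv.
    have /andP[lt_J red_uv] := phi_e u v ltp (ltk v) Euv.
    rewrite /color_edge [col _]red_uv andbT /=.
    by rewrite neq_ltn position_lt_interval.
  move=> u v Euv; case: (ltgtP u v) => [lt_uv|lt_vu|Euv'].
  - exact: edge_lt.
  - by rewrite /edge /= color_edge_sym; apply: edge_lt => //; rewrite edge_sym.
  - by rewrite Euv' edge_irr in Euv.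
have [|z subz] := @ramsey_clique _ (fun l l' => r (l, x l) (l', x l')) k n (enum 'I_L).
  by rewrite size_enum_ord.
case=> [[szz prz]|[szz prz]].
  case/negP: noJ; apply/existsP; exists (Tuple (introT eqP szz)).
  by rewrite prz andbT (subseq_uniq subz) ?enum_uniq.
have z_lt i j : i < j -> j < n -> nth l0 z i < nth l0 z j.
  move=> ltij ltjn; have tr : transitive (relpre (@nat_of_ord L) ltn).
    by move=> b a' c' /=; apply: ltn_trans.
  have srt : sorted (relpre (@nat_of_ord L) ltn) z.
    apply: (subseq_sorted tr subz).
    by rewrite -sorted_map val_enum_ord iota_ltn_sorted.
  by apply: (sorted_ltn_nth tr l0 srt) => //; rewrite inE szz // (ltn_trans ltij).
have blue i j : i < j -> j < n ->
    color_edge col false (position (nth l0 z i, x (nth l0 z i)))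
                         (position (nth l0 z j, x (nth l0 z j))).
  move=> ltij ltjn; move/(pairwiseP l0): prz => /(_ i j); rewrite !inE szz.
  move=> /(_ (ltn_trans ltij ltjn) ltjn ltij); rewrite /r /= z_lt //= => /negPf nred.
  by rewrite /color_edge [col _]nred andbT /= neq_ltn position_lt_interval ?z_lt.
exists (fun i : 'I_n => position (nth l0 z i, x (nth l0 z i))); split=> i j /=.
  by rewrite !ltEord => ltij; apply: position_lt_interval; apply: z_lt.
rewrite neq_ltn => /orP[ltij|ltji]; first exact: blue.
by rewrite color_edge_sym; apply: blue.
Qed.

Theorem theorem1p4 :
  forall Delta k : nat, 1 <= Delta -> 1 <= k ->
  exists f : nat,
  forall H : ordered_graph,
    max_degree H <= Delta ->
    interval_chromatic_number H <= k ->
    exists C : nat,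
    forall n : nat, 1 <= n ->
    exists R : nat,
      is_ordered_ramsey_number H (complete n) R /\ R <= C * n ^ f.
Proof.
move=> [//|d] k _ _; have [f Hf] := polynomial_ramsey_property d k.
exists (k + k * k * f) => H degH chiH; have [c Hc] := Hf H degH chiH.
exists c => n n_gt0; have [R minR leR] := exists_least (Hc n n_gt0).
by exists R; split=> //; rewrite mulnCA -expnM -expnD in leR.
Qed.
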